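(* Let $\mathcal{L}\subseteq \mathbb{C}^n$ be a $d$-dimensional linear subspace, let $I\subseteq[n]$, and let $\mathcal{I}\subseteq\mathbb{C}[x_1,\dots,x_n]$ be the ideal of all polynomials vanishing on the affine variety $\mathrm{inv}_I(\mathcal{L})$. Then $\{f_C : C \text{ is a circuit of } M(\mathcal{L})\}$ is a universal Gröbner basis for $\mathcal{I}$. Moreover, for every $w\in(\mathbb{R}_{>0})^n$ with pairwise distinct coordinates, the initial ideal $\mathrm{in}_w(\mathcal{I})$ equals the Stanley–Reisner ideal of the simplicial complex $\Delta_w(M(\mathcal{L}),I)$.
   Context: For $I\subseteq[n]$, $\mathrm{inv}_I:\mathbb{C}^n\dashrightarrow\mathbb{C}^n$ is the rational map with $(\mathrm{inv}_I(x))_i=1/x_i$ for $i\in I$ and $x_i$ for $i\notin I$; $\mathrm{inv}_I(\mathcal{L})$ denotes the Zariski closure of the image of (the points of $\mathcal{L}$ where the map is defined). A linear form $\ell=\sum a_ix_i$ vanishes on $\mathcal{L}$ if $\ell(x)=0$ for all $x\in\mathcal{L}$; its support is $\{i:a_i\neq0\}$. The circuits of the matroid $M(\mathcal{L})$ on $[n]$ are the inclusion-minimal supports of nonzero linear forms vanishing on $\mathcal{L}$; for each circuit $C$ there is a unique up to scaling linear form $\ell_C=\sum_{i\in C}a_ix_i$ vanishing on $\mathcal{L}$ with support $C$. For $S\subseteq[n]$ write $\mathbf{x}^S=\prod_{i\in S}x_i$. The circuit polynomial is $f_C=\mathbf{x}^{C\cap I}\ell_C(\mathrm{inv}_I(\mathbf{x}))=\sum_{i\in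 C\cap I}a_i\mathbf{x}^{(C\cap I)\setminus\{i\}}+\sum_{i\in C\setminus I}a_i\mathbf{x}^{(C\cap I)\cup\{i\}}$. For $w\in(\mathbb{R}_{\ge0})^n$ and $f=\sum c_\alpha\mathbf{x}^\alpha$, $\mathrm{in}_w(f)$ is the sum of the terms $c_\alpha\mathbf{x}^\alpha$ with $c_\alpha\ne0$ maximizing $w^T\alpha$, and $\mathrm{in}_w(\mathcal{I})=\langle\mathrm{in}_w(f):f\in\mathcal{I}\rangle$; a finite subset $F\subseteq\mathcal{I}$ is a universal Gröbner basis if it is a Gröbner basis for every monomial order (equivalently $\mathrm{in}_w(F)$ generates $\mathrm{in}_w(\mathcal{I})$ for all $w\in(\mathbb{R}_{\ge0})^n$). A vector $w\in\mathbb{R}^n$ with distinct coordinates orders $[n]$ by $i<j$ iff $w_i<w_j$. For a circuit $C$ of a matroid $M$ on $[n]$, its $I$-broken circuit is $b_I(C)=C\setminus\min(C)$ if $C\subseteq I$, and $b_I(C)=(C\cap I)\cup\{\max(C\setminus I)\}$ if $C\not\subseteq I$ (min/max in the $w$-order). The semi-broken ($I$-broken) circuit complex $\Delta_w(M,I)$ is the collection of subsets $\tau\subseteq[n]$ containing no $I$-broken circuit of $M$. The Stanley–Reisner ideal of a simplicial complex $\Delta$ on $[n]$ is $\langle\mathbf{x}^S: S\subseteq[n], S\notin\Delta\rangle$. *)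

(* Defs.v *)
From HB Require Import structures.
From mathcomp Require Import all_boot all_order all_algebra.
From mathcomp Require Import classical_sets cardinality reals.
From mathcomp Require Import complex mpoly.

Set Implicit Arguments.
Unset Strict Implicit.
Unset Printing Implicit Defensive.

Import Order.TTheory GRing.Theory Num.Theory.
Local Open Scope ring_scope.

Section AffineVarieties.
Variables (K : fieldType) (n : nat).
Implicit Types (S : set 'rV[K]_n) (I : {set 'I_n}) (x : 'rV[K]_n).

Definition vanishing_ideal S : set {mpoly K[n]} :=
  [set p | forall x, S x -> p.@[x 0] = 0]%classic.

Definition zariski_closure S : set 'rV[K]_n :=
  [set x | forall p, vanishing_ideal S p -> p.@[x 0] = 0]%classic.

(* The rational map inv_I is given by [inv_coords I] on its domain of
   definition [inv_domain I]; outside of it MathComp's [0^-1 = 0] is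
   meaningless, hence the restriction in [inv_variety]. *)
Definition inv_coords I x : 'rV[K]_n :=
  \row_i (if i \in I then (x 0 i)^-1 else x 0 i).

Definition inv_domain I : set 'rV[K]_n :=
  [set x | forall i, i \in I -> x 0 i != 0]%classic.

Definition inv_variety I (L : {vspace 'rV[K]_n}) : set 'rV[K]_n :=
  zariski_closure
    [set inv_coords I x | x in [set x | x \in L /\ inv_domain I x]]%classic.

End AffineVarieties.

Section Circuits.
Variables (K : fieldType) (n : nat).
Implicit Types (L : {vspace 'rV[K]_n}) (I C S : {set 'I_n}) (a x : 'rV[K]_n).

(* A row vector [a] stands for the linear form \sum_i a_i x_i. *)
Definition linear_form a x : K := \sum_i a 0 i * x 0 i.

Definition vanishes_on L a : Prop := forall x, x \in L -> linear_form a x = 0.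

Definition form_support a : {set 'I_n} := [set i | a 0 i != 0].

Definition dependent_support L S : Prop :=
  exists a, [/\ a != 0, vanishes_on L a & form_support a = S].

Definition circuit L : set {set 'I_n} :=
  [set C | dependent_support L C /\
           forall S, dependent_support L S -> S \subset C -> S = C]%classic.

Definition circuit_form L C a : Prop := vanishes_on L a /\ form_support a = C.

Definition sqfree_monomial S : {mpoly K[n]} := \prod_(i in S) 'X_i.

Definition circuit_poly I C a : {mpoly K[n]} :=
    \sum_(i in C :&: I) a 0 i *: sqfree_monomial ((C :&: I) :\ i)
  + \sum_(i in C :\: I) a 0 i *: sqfree_monomial (i |: (C :&: I)).

(* f_C = x^(C :&: I) * l_C(inv_I(x)) as functions on the domain of inv_I. *)
Lemma circuit_polyE I C a x :
  form_support a = C -> inv_domain I x ->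
  (circuit_poly I C a).@[x 0] =
    \prod_(i in C :&: I) x 0 i * linear_form a (inv_coords I x).
Proof.
have evM S : (sqfree_monomial S).@[x 0] = \prod_(i in S) x 0 i.
  by rewrite rmorph_prod; apply: eq_bigr => i _; exact: mevalXU.
move=> aC xI; rewrite /circuit_poly mevalD !raddf_sum /=.
have -> : linear_form a (inv_coords I x) =
    \sum_(i in C) a 0 i * inv_coords I x 0 i.
  rewrite /linear_form big_mkcond [RHS]big_mkcond /=; apply: eq_bigr => i _.
  case: ifP => //; rewrite -aC inE => /negbFE /eqP ->; exact: mul0r.
rewrite mulr_sumr [RHS](big_setID I) /=; congr (_ + _); apply: eq_bigr => i.
- rewrite inE => /andP[iC iI]; rewrite mevalZ evM mxE iI.
  rewrite [in RHS](bigD1 i) ?inE ?iC //= [RHS]mulrCA; congr (_ * _).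
  rewrite mulrAC divff ?xI // mul1r.
  by apply: eq_bigl => j; rewrite finset.in_setD1 andbC.
- rewrite finset.in_setD => /andP[/negbTE iI iC]; rewrite mevalZ evM mxE iI.
  by rewrite big_setU1 ?inE ?iI ?andbF //= [RHS]mulrCA [X in _ = _ * X]mulrC.
Qed.

End Circuits.

Section GroebnerBases.
Variables (K : fieldType) (n : nat).
Implicit Types (le : rel 'X_{1..n}) (f p : {mpoly K[n]}).
Implicit Types (F G J : set {mpoly K[n]}).

Definition ideal_generated G : set {mpoly K[n]} :=
  [set p | exists s : seq ({mpoly K[n]} * {mpoly K[n]}),
    (forall q, q \in s -> G q.2) /\ p = \sum_(q <- s) q.1 * q.2]%classic.

(* The sum of the [le]-maximal terms of [f], for a total preorder [le]: this is
   the leading term when [le] is a monomial order, and in_w(f) when [le] is the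
   preorder [weight_le w] given by a weight vector. *)
Definition initial_form le f : {mpoly K[n]} :=
  \sum_(m <- msupp f | all (fun m' => le m' m) (msupp f)) f@_m *: 'X_[m].

Definition initial_ideal le J : set {mpoly K[n]} :=
  ideal_generated [set initial_form le f | f in J]%classic.

Definition monomial_order le : Prop :=
  [/\ total le, antisymmetric le, transitive le,
      forall m, le 0%MM m
    & forall m1 m2 m, le m1 m2 -> le (m + m1)%MM (m + m2)%MM].

Definition groebner_basis le F J : Prop :=
  [/\ finite_set F, (F `<=` J)%classic
    & ideal_generated [set initial_form le f | f in F]%classic =
      initial_ideal le J].

Definition universal_groebner_basis F J : Prop :=
  [/\ finite_set F, (F `<=` J)%classic
    & forall le, monomial_order le -> groebner_basis le F J].

End GroebnerBases.

Definition weight_le (R : realType) (n : nat) (w : 'I_n -> R) : rel 'X_{1..n} :=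
  fun m m' => \sum_i w i * (m i)%:R <= \sum_i w i * (m' i)%:R.

Section BrokenCircuits.
Variables (R : realType) (n : nat) (w : 'I_n -> R).
Implicit Types (I C S T : {set 'I_n}).

(* {min S} and {max S} for the order of [n] induced by an injective [w]; both
   are empty when [S] is. *)
Definition wmin S : {set 'I_n} := [set i in S | [forall j in S, w i <= w j]].
Definition wmax S : {set 'I_n} := [set i in S | [forall j in S, w j <= w i]].

Definition broken_circuit I C : {set 'I_n} :=
  if C \subset I then C :\: wmin C else (C :&: I) :|: wmax (C :\: I).

(* [M] is the set of circuits of a matroid. *)
Definition broken_circuit_complex (M : set {set 'I_n}) I : set {set 'I_n} :=
  [set T : {set 'I_n} |
     forall C, M C -> ~~ (broken_circuit I C \subset T)]%classic.

End BrokenCircuits.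

Definition stanley_reisner_ideal (K : fieldType) (n : nat)
    (Delta : set {set 'I_n}) : set {mpoly K[n]} :=
  ideal_generated [set sqfree_monomial K S | S in ~` Delta]%classic.

(* Main.v *)
(* Call a monomial standard if its support contains no I-broken circuit. The
   leading monomial of f_C is x^(b_I(C)), and every other monomial of f_C has at
   most the same degree; so dividing by the f_C terminates, and every polynomial
   is congruent modulo the ideal to a combination of standard monomials. Hence
   both claims reduce to the linear independence of the standard monomials as
   functions on inv_I(L).

   Independence is proved by deletion and contraction on a ground set E
   containing I. Let i be the last element of I, or of E if I is empty. If x_i
   occurs in no monomial of the combination, delete i. Otherwise clear
   denominators, factor out the lowest power of x_i (for i in I this is the
   highest pole order) and restrict to x_i = 0: what remains is a combination of
   standard monomials of the contraction L /\ {x_i = 0}. *)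

Require Import Defs.
From mathcomp Require Import all_boot all_order all_algebra.
From mathcomp Require Import classical_sets reals.
From mathcomp Require Import complex mpoly.
From mathcomp Require Import boolp cardinality ring fintype finset.
Import Order.TTheory GRing.Theory Num.Theory.
Local Open Scope ring_scope.
Local Open Scope complex_scope.

Set Implicit Arguments.
Unset Strict Implicit.
Unset Printing Implicit Defensive.

(** * Polynomials that do not vanish identically on a linear subspace *)

Section PolynomialsOnSubspaces.
Variables (K : numFieldType) (n : nat).
Implicit Types (L : {vspace 'rV[K]_n}) (F G : {mpoly K[n]}).

Lemma meval_line F (p q : 'rV[K]_n) :
  exists P : {poly K}, forall t, P.[t] = F.@[(p + t *: (q - p)) 0].
Proof.
exists (\sum_(m <- msupp F)
  F@_m *: \prod_i ((p 0 i)%:P + (q 0 i - p 0 i) *: 'X) ^+ m i) => t.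
rewrite mevalE horner_sum; apply: eq_bigr => m _.
rewrite hornerZ horner_prod; congr (_ * _); apply: eq_bigr => i _.
by rewrite horner_exp !hornerE !mxE [t * _]mulrC.
Qed.

(** In characteristic zero the first [size P] natural numbers are distinct in [K], and a nonzero [P]
    has fewer roots than that. *)
Lemma nonroot_exists (P : {poly K}) : P != 0 -> exists t, P.[t] != 0.
Proof.
move=> P0; pose s := [seq k%:R : K | k <- iota 0 (size P)].
have us : uniq s by rewrite map_inj_uniq ?iota_uniq //; apply: mulrIn; exact: oner_neq0.
have /allPn[t _ Pt] : ~~ all (root P) s.
  by apply/negP => /max_poly_roots -/(_ P0 us); rewrite size_map size_iota ltnn.
by exists t.
Qed.

(** Irreducibility of [L]: on the line through [p] and [q] both factors restrict to nonzero
    univariate polynomials, as [F] survives at [t = 0] and [G] at [t = 1]. *)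
Lemma meval_mul_neq0 L F G :
  (exists2 x, x \in L & F.@[x 0] != 0) -> (exists2 x, x \in L & G.@[x 0] != 0) ->
  exists2 x, x \in L & (F * G).@[x 0] != 0.
Proof.
move=> [p pL Fp] [q qL Gq].
have [P PE] := meval_line F p q; have [Q QE] := meval_line G p q.
have P0 : P != 0.
  by apply: contraNneq Fp => P0; have := PE 0; rewrite P0 horner0 scale0r addr0 => <-.
have Q0 : Q != 0.
  apply: contraNneq Gq => Q0; have := QE 1.
  by rewrite Q0 horner0 scale1r addrC subrK => <-.
have [t] := nonroot_exists (mulf_neq0 P0 Q0).
rewrite hornerM PE QE -mevalM => FGt; exists (p + t *: (q - p)) => //.
by rewrite memvD ?memvZ ?memvB.
Qed.

Lemma meval_prod_neq0 L (A : {set 'I_n}) :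
  (forall i, i \in A -> exists2 x, x \in L & x 0 i != 0) ->
  exists2 x, x \in L & (\prod_(i in A) 'X_i : {mpoly K[n]}).@[x 0] != 0.
Proof.
move=> AL; apply: (big_ind (fun F : {mpoly K[n]} => exists2 x, x \in L & F.@[x 0] != 0)).
- by exists 0; rewrite ?mem0v // meval1 oner_eq0.
- exact: meval_mul_neq0.
- by move=> i /AL[x xL xi]; exists x => //; rewrite mevalXU.
Qed.

Lemma meval_exp_neq0 L i k :
  (exists2 x, x \in L & x 0 i != 0) ->
  exists2 x, x \in L & ('X_i ^+ k : {mpoly K[n]}).@[x 0] != 0.
Proof. by move=> [x xL xi]; exists x => //; rewrite rmorphXn /= mevalXU expf_neq0. Qed.

End PolynomialsOnSubspaces.

(** * Broken supports and independence of standard monomials *)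

Section BrokenSupports.
Variables (K : numFieldType) (n : nat) (r : rel 'I_n).
Hypotheses (r_total : total r) (r_anti : antisymmetric r) (r_trans : transitive r).
Implicit Types (L : {vspace 'rV[K]_n}) (I C D E S : {set 'I_n}) (a b x v : 'rV[K]_n).

Lemma exists_last C : C != set0 -> exists2 i, i \in C & forall j, j \in C -> r j i.
Proof.
case/set0Pn => i0 i0C.
have [|x y z xy yz|x y||i iC imax] := @extremumP _ _ (fun i j => r j i) i0 (mem C) id.
- by move=> x; have := r_total x x; rewrite orbb.
- exact: r_trans yz xy.
- exact: r_total.
- exact: i0C.
- by exists i.
Qed.

(* [broken_circuit] with the order of [n] given by a relation. *)
Definition broken I C : {set 'I_n} :=
  if C \subset I then C :\: [set i in C | [forall j in C, r i j]]
  else (C :&: I) :|: [set i in C :\: I | [forall j in C :\: I, r j i]].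

Lemma in_broken_sub I C j : C \subset I ->
  (j \in broken I C) = (j \in C) && ~~ [forall k in C, r j k].
Proof.
move=> CI; rewrite /broken CI in_setD inE andbC.
by case: (j \in C).
Qed.

Lemma in_broken_nsub I C j : ~~ (C \subset I) ->
  (j \in broken I C) =
  (j \in C) && ((j \in I) || [forall k in C :\: I, r k j]).
Proof.
move=> /negbTE CI; rewrite /broken CI !inE.
by case: (j \in C); case: (j \in I).
Qed.

(* All linear dependencies are tested instead of the circuits only: they are
   easier to lift along a contraction, and [nbc_circuit] shows that this is no
   restriction. *)
Definition nbc L I E S : Prop :=
  forall a, a != 0 -> vanishes_on L a -> form_support a \subset E ->
    ~~ (broken I (form_support a) \subset S).

Definition coord_hyperplane i : {vspace 'rV[K]_n} :=
  lker (linfun (col i : 'rV[K]_n -> 'M[K]_1)).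

Lemma mem_coord_hyperplane i x : (x \in coord_hyperplane i) = (x 0 i == 0).
Proof.
rewrite memv_ker lfunE /=; apply/eqP/eqP => [/matrixP/(_ 0 0)|xi].
  by rewrite !mxE.
by apply/matrixP=> k l; rewrite !mxE ord1.
Qed.

Lemma form_supportP a i : reflect (a 0 i = 0) (i \notin form_support a).
Proof. by rewrite inE negbK; exact: eqP. Qed.

Lemma form_support_eq0 a : (form_support a == set0) = (a == 0).
Proof.
apply/eqP/eqP => [a0|->]; last by apply/setP => i; rewrite !inE mxE eqxx.
by apply/rowP => i; rewrite mxE; apply/form_supportP; rewrite a0 inE.
Qed.

Lemma linear_formDl a b x : linear_form (a + b) x = linear_form a x + linear_form b x.
Proof. by rewrite /linear_form -big_split; apply: eq_bigr => i _; rewrite mxE mulrDl. Qed.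

Lemma linear_formZl c a x : linear_form (c *: a) x = c * linear_form a x.
Proof. by rewrite /linear_form mulr_sumr; apply: eq_bigr => i _; rewrite mxE mulrA. Qed.

Lemma linear_formDr a x y : linear_form a (x + y) = linear_form a x + linear_form a y.
Proof. by rewrite /linear_form -big_split; apply: eq_bigr => i _; rewrite mxE mulrDr. Qed.

Lemma linear_formZr c a x : linear_form a (c *: x) = c * linear_form a x.
Proof. by rewrite /linear_form mulr_sumr; apply: eq_bigr => i _; rewrite mxE mulrCA. Qed.

Lemma linear_form_delta i x : linear_form (delta_mx 0 i) x = x 0 i.
Proof.
rewrite /linear_form (bigD1 i) //= mxE !eqxx mul1r big1 ?addr0 // => j /negbTE ji.
by rewrite mxE ji andbF mul0r.
Qed.

(** [L] is spanned by [v] and its part in the hyperplane, so [c] only has to make the lifted form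
    vanish at [v]. *)
Lemma vanishes_lift L i a v : v \in L -> v 0 i != 0 ->
  vanishes_on (L :&: coord_hyperplane i) a ->
  exists c, vanishes_on L (a + c *: delta_mx 0 i).
Proof.
move=> vL vi aL; exists (- ((v 0 i)^-1 * linear_form a v)) => x xL.
have /aL : x - (x 0 i / v 0 i) *: v \in (L :&: coord_hyperplane i)%VS.
  by rewrite memv_cap memvB ?memvZ //= mem_coord_hyperplane !mxE divfK ?subrr.
rewrite -scaleNr linear_formDr linear_formZr linear_formDl linear_formZl.
by rewrite linear_form_delta => <-; ring.
Qed.

Lemma form_support_addl a c i : i \notin form_support a ->
  form_support (a + c *: delta_mx 0 i) =
    if c == 0 then form_support a else i |: form_support a.
Proof.
move/form_supportP => ai; case: (eqVneq c 0) => [->|c0].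
  by rewrite scale0r addr0.
apply/setP => j; rewrite !inE !mxE eqxx /=; case: (eqVneq j i) => [->|ji] /=.
  by rewrite ai add0r mulr1.
by rewrite mulr0 addr0.
Qed.

Lemma form_support_delta i : form_support (delta_mx 0 i : 'rV[K]_n) = [set i].
Proof.
apply/setP => j; rewrite !inE mxE eqxx /=; case: (j == i).
  by rewrite oner_eq0.
by rewrite eqxx.
Qed.

Lemma delta_neq0 i : delta_mx 0 i != 0 :> 'rV[K]_n.
Proof.
by rewrite -form_support_eq0 form_support_delta; apply/set0Pn; exists i; rewrite inE.
Qed.

(** Otherwise [[set i]] would support a dependency; its broken set is empty if [i] is in [I] and
    [[set i]] if not, so [S] would contain it. *)
Lemma nbc_nonloop L I E S i : nbc L I E S -> i \in E -> (i \in I) || (i \in S) ->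
  exists2 v, v \in L & v 0 i != 0.
Proof.
move=> LS iE iIS; suff /subvPn[v vL] : ~~ (L <= coord_hyperplane i)%VS.
  by rewrite mem_coord_hyperplane; exists v.
apply/negP => /subvP Li.
have /(LS _ (delta_neq0 i)) : vanishes_on L (delta_mx 0 i).
  by move=> x /Li; rewrite mem_coord_hyperplane linear_form_delta => /eqP.
rewrite form_support_delta sub1set => /(_ iE)/subsetPn[j].
have [iI|iI] := boolP (i \in I).
  rewrite in_broken_sub ?sub1set // inE => /andP[/eqP -> /forall_inP[]] k.
  by rewrite inE => /eqP ->; have := r_total i i; rewrite orbb.
rewrite in_broken_nsub ?sub1set // inE => /andP[/eqP -> _].
by move: iIS; rewrite (negbTE iI) /= => ->.
Qed.

(** The two inclusions serve the two possible supports of a lifted dependency. Adding [i] does not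
    change the minimum of a [C] inside [I], as [i] is last there, nor [C :\: I], as [i] lies in
    [I]. *)
Lemma broken_contract I C i : C != set0 -> i \notin C -> i \in I ->
  (forall j, j \in I -> r j i) ->
  (broken I C \subset i |: broken (I :\ i) C) /\
  (broken I (i |: C) \subset i |: broken (I :\ i) C).
Proof.
move=> C0 iC iI imax.
have CIi : (C \subset I :\ i) = (C \subset I) by rewrite subsetD1 iC andbT.
have iCI : (i |: C \subset I) = (C \subset I) by rewrite subUset sub1set iI.
have [CI|CI] := boolP (C \subset I).
  split; apply/subsetP => j; rewrite in_setU1 !in_broken_sub ?CIi ?iCI //.
    by move=> ->; rewrite orbT.
  rewrite in_setU1; case: (eqVneq j i) => //= ji /andP[jC]; rewrite jC /=.
  apply: contraNN => /forall_inP jmin; apply/forall_inP => k.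
  rewrite in_setU1 => /orP[/eqP ->|/jmin //].
  exact/imax/(subsetP CI).
have CDI : C :\: (I :\ i) = C :\: I.
  apply/setP => j; rewrite !inE negb_and negbK; case: (eqVneq j i) => // ->.
  by rewrite (negbTE iC) !andbF.
have iCDI : (i |: C) :\: I = C :\: I.
  apply/setP => j; rewrite !inE; case: (eqVneq j i) => // ->.
  by rewrite iI.
split; apply/subsetP => j; rewrite in_setU1 !in_broken_nsub ?CIi ?iCI // CDI ?iCDI !inE.
  by case: (eqVneq j i).
by case: (eqVneq j i).
Qed.

Lemma broken_delete I C i : i \notin C -> broken (I :\ i) C = broken I C.
Proof.
move=> iC.
have CIi : (C \subset I :\ i) = (C \subset I) by rewrite subsetD1 iC andbT.
apply/setP => j; have [CI|CI] := boolP (C \subset I).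
  by rewrite !in_broken_sub ?CIi.
rewrite !in_broken_nsub ?CIi //.
have -> : C :\: (I :\ i) = C :\: I.
  apply/setP => k; rewrite !inE negb_and negbK; case: (eqVneq k i) => // ->.
  by rewrite (negbTE iC) !andbF.
rewrite !inE; case: (eqVneq j i) => [->|] //=.
by rewrite (negbTE iC).
Qed.

(** Deletion only shrinks the ground set: [L] is not projected, and a support avoiding [i] keeps its
    broken set. *)
Lemma nbc_delete L I E S i : nbc L I E S -> nbc L (I :\ i) (E :\ i) S.
Proof.
move=> LS a a0 aL; rewrite subsetD1 => /andP[aE ia].
by rewrite broken_delete //; exact: LS.
Qed.

(** Lift a dependency of the contraction to [L]; its broken set gains at most [i], which [S] already
    contains. *)
Lemma nbc_contract L I E S i : nbc L I E S -> i \in I -> i \in E -> i \in S ->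
    (forall j, j \in I -> r j i) ->
  nbc (L :&: coord_hyperplane i) (I :\ i) (E :\ i) S.
Proof.
move=> LS iI iE iS imax a a0 aL; rewrite subsetD1 => /andP[aE ia].
have [|v vL vi] := nbc_nonloop LS iE; first by rewrite iI.
have [c] := vanishes_lift vL vi aL; set b := a + _ => bL.
have bE : form_support b = if c == 0 then form_support a else i |: form_support a.
  exact: form_support_addl.
have aN0 : form_support a != set0 by rewrite form_support_eq0.
have b0 : b != 0.
  rewrite -form_support_eq0 bE; case: ifP => // _.
  by apply/set0Pn; exists i; rewrite !inE eqxx.
have bsE : form_support b \subset E.
  by rewrite bE; case: ifP => // _; rewrite subUset sub1set iE.
have [s1 s2] := broken_contract aN0 ia iI imax.
have := LS b b0 bL bsE; rewrite bE; apply: contraNN => aS.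
by case: ifP => _; [apply: (subset_trans s1)|apply: (subset_trans s2)];
  rewrite subUset sub1set iS.
Qed.

(* The set [T] certifies that no dependency supported in [E] involves [i]. *)
Lemma nbc_contract_free L E S T i : nbc L set0 E T -> i \in T -> i \in E ->
    (forall j, j \in E -> r j i) -> nbc L set0 E S ->
  nbc (L :&: coord_hyperplane i) set0 (E :\ i) S.
Proof.
move=> LT iT iE imax LS a a0 aL; rewrite subsetD1 => /andP[aE ia].
have [|v vL vi] := nbc_nonloop LT iE; first by rewrite iT orbT.
have [c] := vanishes_lift vL vi aL; set b := a + _ => bL.
have : form_support b = if c == 0 then form_support a else i |: form_support a.
  exact: form_support_addl.
have [c0 _|c0 bE] := eqVneq c 0.
  by move: bL; rewrite /b c0 scale0r addr0 => aL'; exact: LS.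
have b0 : b != 0.
  by rewrite -form_support_eq0 bE; apply/set0Pn; exists i; rewrite !inE eqxx.
have bsE : form_support b \subset E.
  by rewrite bE subUset sub1set iE.
(* With no inverted coordinates a broken set is just the maximum of the support, here [i], which
   lies in [T]. So a lift with [c] nonzero is impossible. *)
have /negP[] := LT b b0 bL bsE.
apply/subsetP => j; rewrite in_broken_nsub ?subset0 ?form_support_eq0 //.
rewrite setD0 in_set0 bE => /andP[jD /forall_inP jmax].
have := jmax i; rewrite in_setU1 eqxx => /(_ isT) ij; suff -> : j = i by [].
by apply: r_anti; rewrite ij imax // (subsetP bsE) ?bE.
Qed.

(** * Independence of standard monomials by deletion and contraction *)

Section Independence.
Variables (N : 'I_n -> nat) (c : 'X_{1..n} -> K).
Implicit Types (s : seq 'X_{1..n}) (m : 'X_{1..n}).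

(** The exponent of [x_j] once denominators are cleared; the truncated subtraction is exact only
    under the bound [m j <= N j]. *)
Definition twist_exp I m j : nat := if j \in I then (N j - m j)%N else m j.

(* [\prod_(j in I) x_j^(N j)] times the value at inv_I(x) of the combination of
   the monomials of [s], with the variables outside [E] set to 1. *)
Definition twist I E s : {mpoly K[n]} :=
  \sum_(m <- s) c m *: \prod_(j in E) 'X_j ^+ twist_exp I m j.

Definition mnm_supp m : {set 'I_n} := [set j | m j != 0%N].

Lemma twist_exp_setD1 I m i j : j != i -> twist_exp (I :\ i) m j = twist_exp I m j.
Proof. by move=> ji; rewrite /twist_exp !inE ji. Qed.

Lemma twist_bigD1 I E m i : i \in E ->
  \prod_(j in E) 'X_j ^+ twist_exp I m j =
  'X_i ^+ twist_exp I m i * \prod_(j in E :\ i) 'X_j ^+ twist_exp (I :\ i) m j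
  :> {mpoly K[n]}.
Proof.
move=> iE; rewrite (bigD1 i iE) /=; congr (_ * _); apply: eq_big => [j|j /andP[_ ji]].
  by rewrite !inE andbC.
by rewrite twist_exp_setD1.
Qed.

Lemma twist_delete I E s i : i \in E -> {in s, forall m, m i = 0%N} ->
  twist I E s = 'X_i ^+ (if i \in I then N i else 0) * twist (I :\ i) (E :\ i) s.
Proof.
move=> iE si; rewrite /twist mulr_sumr; apply: eq_big_seq => m ms.
by rewrite (twist_bigD1 _ _ iE) -scalerAr {1}/twist_exp (si _ ms) subn0.
Qed.

(** After division by [x_i^e], setting [x_i] to zero keeps exactly the terms of lowest exponent. The
    quotient is thus nonzero at [p], and irreducibility of [L] restores the factor [x_i^e]. *)
Lemma twist_contract L I E s i e : i \in E ->
    {in s, forall m, (e <= twist_exp I m i)%N} ->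
    (exists2 v, v \in L & v 0 i != 0) ->
    (exists2 p, p \in (L :&: coord_hyperplane i)%VS &
      (twist (I :\ i) (E :\ i) [seq m <- s | twist_exp I m i == e]).@[p 0] != 0) ->
  exists2 x, x \in L & (twist I E s).@[x 0] != 0.
Proof.
move=> iE se Li [p]; rewrite memv_cap mem_coord_hyperplane => /andP[pL /eqP pi] p0.
have -> : twist I E s = 'X_i ^+ e * \sum_(m <- s) c m *:
    ('X_i ^+ (twist_exp I m i - e) *
     \prod_(j in E :\ i) 'X_j ^+ twist_exp (I :\ i) m j).
  rewrite /twist mulr_sumr; apply: eq_big_seq => m ms.
  by rewrite (twist_bigD1 _ _ iE) -scalerAr mulrA -exprD subnKC ?se.
apply: meval_mul_neq0; first exact: meval_exp_neq0.
exists p => //; move: p0; congr (_ != 0); rewrite /twist big_filter big_mkcond.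
rewrite !raddf_sum /=; apply: eq_big_seq => m ms.
rewrite mevalZ mevalM rmorphXn /= mevalXU pi; case: eqP => [->|/eqP em].
  by rewrite subnn mul1r mevalZ.
have -> : (twist_exp I m i - e)%N = (twist_exp I m i - e).-1.+1.
  by rewrite prednK // subn_gt0 ltn_neqAle eq_sym em se.
by rewrite expr0n mul0r mulr0 raddf0.
Qed.

(** Induction on the size of [E]. Agreement of the monomials outside [E] ensures that they are told
    apart by their exponents in [E]; once [E] is empty only one is left and nothing can cancel. *)
Lemma nbc_twist_neq0 L I E s :
    I \subset E -> s != [::] -> uniq s ->
    {in s &, forall m m' j, j \notin E -> m j = m' j} ->
    {in s, forall m, c m != 0 /\ nbc L I E (mnm_supp m)} ->
    {in s, forall m j, (m j <= N j)%N} ->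
  exists2 x, x \in L & (twist I E s).@[x 0] != 0.
Proof.
have [k] := ubnP #|E|; elim: k => // k IHk in L I E s *; rewrite ltnS => Ek.
move=> IE s0 us sE snbc sN.
have [E0|E0] := eqVneq E set0.
  case: s s0 us sE snbc {sN} => // m [|m' s] _ us sE snbc; last first.
    have mm' : m = m'.
      by apply/mnmP => j; apply: sE; rewrite ?E0 ?inE ?eqxx ?orbT.
    by move: us; rewrite mm' /= inE eqxx.
  exists 0; rewrite ?mem0v // /twist big_seq1 mevalZ E0 big_set0 meval1 mulr1.
  by have [] := snbc m (mem_head _ _).
have [i iE imax] : exists2 i, i \in E & if i \in I then forall j, j \in I -> r j i
    else I = set0 /\ forall j, j \in E -> r j i.
  have [I0|/exists_last[i iI imax]] := eqVneq I set0.
    have [i iE imax] := exists_last E0.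
    by exists i => //; rewrite I0 inE; split.
  by exists i; rewrite ?iI // (subsetP IE).
have EiE : (#|E :\ i| < k)%N.
  by apply: leq_trans Ek; rewrite [X in (_ < X)%N](cardsD1 i) iE.
have IiE : I :\ i \subset E :\ i by exact: setSD.
have [/allP si|] := boolP (all (fun m => m i == 0%N) s).
  rewrite (twist_delete _ iE); last by move=> m /si/eqP.
  apply: meval_mul_neq0; last first.
    apply: IHk => // [m m' ms m's j|m ms].
      rewrite !inE negb_and negbK; case: eqVneq => [-> _|_] /=; last exact: sE.
      by rewrite (eqP (si _ ms)) (eqP (si _ m's)).
    by have [cm mnbc] := snbc m ms; split=> //; exact: nbc_delete.
  (* The split-off factor is [x_i^(N i)] for [i] in [I], nonzero somewhere on [L] because [i] is not
     a loop, and 1 otherwise. *)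
  have [iI|iI] := boolP (i \in I); last first.
    by exists 0; rewrite ?mem0v // expr0 meval1 oner_eq0.
  have [m ms] : exists m, m \in s.
    by case: s s0 {us sE snbc sN si} => // m; exists m; exact: mem_head.
  apply: meval_exp_neq0; have [_ mnbc] := snbc m ms.
  by apply: (nbc_nonloop mnbc iE); rewrite iI.
case/allPn => m0 m0s m0i.
have [e0 /hasP[m1 m1s /eqP m1e] emin] : exists2 e, has (fun m => twist_exp I m i == e) s &
    {in s, forall m, (e <= twist_exp I m i)%N}.
  have exe : exists e, has (fun m => twist_exp I m i == e) s.
    by exists (twist_exp I m0 i); apply/hasP; exists m0.
  case: (ex_minnP exe) => e es emin; exists e => // m ms.
  by apply: emin; apply/hasP; exists m.
have s'nbc : {in [seq m <- s | twist_exp I m i == e0], forall m,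
    nbc (L :&: coord_hyperplane i) (I :\ i) (E :\ i) (mnm_supp m)}.
  move=> m; rewrite mem_filter => /andP[/eqP me ms].
  have [_ mnbc] := snbc m ms; have [_ m0nbc] := snbc m0 m0s.
  move: imax; case: ifPn => [iI imax|iI [I0 imax]].
    apply: nbc_contract => //; rewrite inE.
    (* Lowest twisted exponent means highest exponent in [m], at least [m0 i > 0]; so [i] is in the
       support of [m]. *)
    have := emin m0 m0s; rewrite -me /twist_exp iI; apply: contraTneq => ->.
    by rewrite subn0 -ltnNge ltn_subrL lt0n m0i (leq_trans _ (sN m0 m0s i)) ?lt0n.
  (* Now [m] may avoid [i]; the support of [m0], which contains [i], is the certificate. *)
  rewrite I0 in mnbc m0nbc *; rewrite set0D.
  by apply: (nbc_contract_free m0nbc) => //; rewrite inE.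
have Li : exists2 v, v \in L & v 0 i != 0.
  have [_ m0nbc] := snbc m0 m0s; apply: (nbc_nonloop m0nbc iE).
  by rewrite inE m0i orbT.
apply: (twist_contract iE emin Li); apply: IHk => //.
- by rewrite -has_filter; apply/hasP; exists m1; rewrite ?m1e.
- exact: filter_uniq.
- move=> m m'; rewrite !mem_filter => /andP[/eqP me ms] /andP[/eqP m'e m's] j.
  rewrite !inE negb_and negbK; case: eqVneq => [-> _|_] /=; last exact: sE.
  (* The retained monomials have equal twisted exponents at [i], hence equal exponents there,
     because [N i] bounds both. *)
  have := etrans me (esym m'e); rewrite /twist_exp; case: ifP => // _ mm'.
  by rewrite -(subKn (sN m ms i)) mm' subKn // sN.
- move=> m ms'; split; last exact: s'nbc.
  by move: ms'; rewrite mem_filter => /andP[_ /snbc[]].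
- by move=> m; rewrite mem_filter => /andP[_ /sN].
Qed.

End Independence.

End BrokenSupports.

(** * Circuits and their polynomials *)

Section CircuitsInSupports.
Variables (K : numFieldType) (n : nat) (r : rel 'I_n).
Hypotheses (r_total : total r) (r_anti : antisymmetric r) (r_trans : transitive r).
Implicit Types (L : {vspace 'rV[K]_n}) (I C S : {set 'I_n}) (a b : 'rV[K]_n).

(** Circuit elimination: given a smaller dependency [b], pass to [b] if it involves [i]; otherwise
    subtract a multiple of [b] that kills some [j] and leaves the coefficient at [i] alone. *)
Lemma exists_circuit L a i : vanishes_on L a -> i \in form_support a ->
  exists C, [/\ circuit L C, i \in C & C \subset form_support a].
Proof.
have [k] := ubnP #|form_support a|; elim: k a => // k IHk a; rewrite ltnS => ak aL ia.
have a0 : a != 0 by rewrite -form_support_eq0; apply/set0Pn; exists i.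
have [amin|] := EM (forall S, dependent_support L S ->
    S \subset form_support a -> S = form_support a).
  by exists (form_support a); split=> //; split=> //; exists a.
move=> /existsNP[S /not_implyP[[b [b0 bL <-]] /not_implyP[ba baN]]].
have bpa : form_support b \proper form_support a.
  by rewrite properEneq ba andbT; apply/eqP.
have [ib|ib] := boolP (i \in form_support b).
  have [C [Cc iC Cb]] := IHk b (leq_trans (proper_card bpa) ak) bL ib.
  by exists C; split => //; exact: subset_trans Cb ba.
have [j jb] : exists j, j \in form_support b by apply/set0Pn; rewrite form_support_eq0.
have ja := subsetP ba _ jb.
pose a' := a - (a 0 j / b 0 j) *: b.
have a'a : form_support a' \subset form_support a :\ j.
  apply/subsetP => l; rewrite in_setD1 inE !mxE; apply: contraR.
  rewrite negb_and negbK => /orP[/eqP ->|la].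
    by rewrite divfK ?subrr //; move: jb; rewrite inE.
  have /form_supportP-> := la.
  have /form_supportP-> : l \notin form_support b by apply: contra la => /(subsetP ba).
  by rewrite mulr0 subr0.
have a'k : (#|form_support a'| < k)%N.
  apply: leq_trans ak; apply: leq_ltn_trans (subset_leq_card a'a) _.
  by rewrite [X in (_ < X)%N](cardsD1 j) ja.
have a'L : vanishes_on L a'.
  by move=> x xL; rewrite linear_formDl -scaleNr linear_formZl aL // bL // mulr0 addr0.
have ia' : i \in form_support a'.
  by move: ia; rewrite !inE !mxE; have /form_supportP-> := ib; rewrite mulr0 subr0.
have [C [Cc iC Ca']] := IHk a' a'k a'L ia'.
exists C; split=> //; apply: subset_trans Ca' (subset_trans a'a _).
exact: subsetDl.
Qed.

(** Inside [I] any circuit works: a non-minimal element of [C] is not minimal in the larger support.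
    Otherwise the circuit must pass through the maximum of the support outside [I], so that both
    have the same maximum there. *)
Lemma exists_circuit_broken L I a : a != 0 -> vanishes_on L a ->
  exists2 C, circuit L C & broken r I C \subset broken r I (form_support a).
Proof.
rewrite -form_support_eq0 => a0 aL; set D := form_support a in a0 *.
have [DI|DI] := boolP (D \subset I).
  have /set0Pn[i iD] := a0; have [C [Cc _ CD]] := exists_circuit aL iD.
  exists C => //; apply/subsetP => j.
  rewrite !in_broken_sub // ?(subset_trans CD) // => /andP[jC].
  rewrite (subsetP CD) //=; apply: contraNN => /forall_inP jmin.
  by apply/forall_inP => k /(subsetP CD)/jmin.
have [i +] : exists2 i, i \in D :\: I & forall j, j \in D :\: I -> r j i.
  by apply: (exists_last r_total r_trans); rewrite setD_eq0.
rewrite inE => /andP[iI iD] imax; have [C [Cc iC CD]] := exists_circuit aL iD.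
exists C => //; apply/subsetP => j; rewrite !in_broken_nsub //; last first.
  by apply/negP => /subsetP/(_ i iC); rewrite (negbTE iI).
move=> /andP[jC]; rewrite (subsetP CD) //=; case: (boolP (j \in I)) => //= jI.
move=> /forall_inP jmax; suff -> : j = i by apply/forall_inP.
apply: r_anti; rewrite imax ?jmax //; first by rewrite inE iI.
by rewrite inE jI (subsetP CD).
Qed.

Lemma nbc_circuit L I S :
  (forall C, circuit L C -> ~~ (broken r I C \subset S)) ->
  nbc r L I setT S.
Proof.
move=> CS a a0 aL _; have [C Cc Ca] := exists_circuit_broken I a0 aL.
by apply: contra (CS C Cc); exact: subset_trans.
Qed.

Lemma circuit_neq0 L C : circuit L C -> C != set0.
Proof. by move=> [[a [a0 _ <-]] _]; rewrite form_support_eq0. Qed.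

End CircuitsInSupports.

Section CircuitPolynomials.
Variables (K : numFieldType) (n : nat).
Implicit Types (L : {vspace 'rV[K]_n}) (I C S : {set 'I_n}) (a : 'rV[K]_n).

Definition mnm_set S : 'X_{1..n} := [multinom (j \in S : nat) | j < n].

Lemma sqfree_monomialE S : sqfree_monomial K S = 'X_[mnm_set S].
Proof.
rewrite mpolyXE_id /sqfree_monomial big_mkcond; apply: eq_bigr => i _.
by rewrite mnmE; case: (i \in S).
Qed.

Lemma mnm_set_setU1 i S : i \notin S -> mnm_set (i |: S) = (U_(i) + mnm_set S)%MM.
Proof.
move=> iS; apply/mnmP => j; rewrite mnmDE mnm1E !mnmE in_setU1 eq_sym.
by case: eqVneq => // <-; rewrite (negbTE iS).
Qed.

Lemma mdeg_mnm_set S : mdeg (mnm_set S) = #|S|.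
Proof.
rewrite mdegE -sum1_card [RHS]big_mkcond; apply: eq_bigr => i _.
by rewrite mnmE; case: (i \in S).
Qed.

Lemma mnm_set_supp m : (mnm_set (mnm_supp m) <= m)%MM.
Proof.
by apply/mnm_lepP => j; rewrite mnmE inE; case: (m j).
Qed.

Lemma mnm_set_le S m : S \subset mnm_supp m -> (mnm_set S <= m)%MM.
Proof.
move=> /subsetP Sm; apply/mnm_lepP => j; rewrite mnmE.
by case: (boolP (j \in S)) => // /Sm; rewrite inE lt0n.
Qed.

Lemma mnm_supp_set S : mnm_supp (mnm_set S) = S.
Proof. by apply/setP => j; rewrite inE mnmE; case: (j \in S). Qed.

(** The exponent of the term of the circuit polynomial that carries the coefficient [a 0 i]. *)
Definition circuit_mnm I C i : 'X_{1..n} :=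
  mnm_set (if i \in I then (C :&: I) :\ i else i |: (C :&: I)).

Lemma circuit_poly_sum I C a :
  circuit_poly I C a = \sum_(i in C) a 0 i *: 'X_[circuit_mnm I C i].
Proof.
rewrite (big_setID I) /circuit_poly; congr (_ + _); apply: eq_bigr => i; rewrite inE.
  by move=> /andP[_ iI]; rewrite sqfree_monomialE /circuit_mnm iI.
by move=> /andP[/negbTE iI _]; rewrite sqfree_monomialE /circuit_mnm iI.
Qed.

End CircuitPolynomials.

(** * Monomial preorders and the leading monomials of circuit polynomials *)

Section MonomialPreorders.
Variables (n : nat) (le : rel 'X_{1..n}).

(** Common ground of monomial orders and positive weights with distinct coordinates. Distinct
    monomials may tie, distinct variables may not; this suffices for a unique leading term of each
    circuit polynomial. *)
Record generic_preorder : Prop := GenericPreorder {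
  gp_total : total le;
  gp_trans : transitive le;
  gp_add : forall m m1 m2, le (m + m1)%MM (m + m2)%MM = le m1 m2;
  gp_pos : forall m, le m 0%MM -> m = 0%MM;
  gp_inj : forall i j, le U_(i)%MM U_(j)%MM -> le U_(j)%MM U_(i)%MM -> i = j }.

Definition var_order : rel 'I_n := fun i j => le U_(i)%MM U_(j)%MM.

Hypothesis leP : generic_preorder.

Lemma var_order_total : total var_order.
Proof. by move=> i j; exact: gp_total. Qed.

Lemma var_order_trans : transitive var_order.
Proof. by move=> i j k; exact: (gp_trans leP). Qed.

Lemma var_order_anti : antisymmetric var_order.
Proof. by move=> i j /andP[]; exact: gp_inj. Qed.

Lemma gp_refl : reflexive le.
Proof. by move=> m; have := gp_total leP m m; rewrite orbb. Qed.

(** If [C] lies in [I], the largest term omits the smallest variable. Otherwise it contains the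
    largest variable of [C :\: I], and the terms for [i] in [I] properly divide it. The degree bound
    makes division terminate. *)
Lemma circuit_mnm_lead (I C : {set 'I_n}) : C != set0 ->
  exists i0, [/\ i0 \in C, circuit_mnm I C i0 = mnm_set (broken var_order I C) &
    forall i, i \in C -> i != i0 ->
      ~~ le (circuit_mnm I C i0) (circuit_mnm I C i) /\
      (mdeg (circuit_mnm I C i) <= mdeg (circuit_mnm I C i0))%N].
Proof.
move=> C0; have [CI|CI] := boolP (C \subset I).
  have [i0 i0C imin] : exists2 i, i \in C & forall j, j \in C -> var_order i j.
    apply: (@exists_last _ (fun i j => var_order j i)) => //.
      by move=> i j; exact: var_order_total.
    by move=> i j k ij jk; exact: var_order_trans jk ij.
  have CE i : i \in C -> circuit_mnm I C i = mnm_set (C :\ i).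
    by move=> iC; rewrite /circuit_mnm (subsetP CI) // (setIidPl CI).
  exists i0; split=> // [|i iC ii0].
    rewrite CE //; congr mnm_set; apply/setP => j; rewrite in_broken_sub // in_setD1 andbC.
    have [jC|//] := boolP (j \in C); congr (~~ _); apply/eqP/forall_inP => [->//|jmin].
    by apply: var_order_anti; rewrite jmin ?imin.
  rewrite !CE // !mdeg_mnm_set; split; last first.
    by have := cardsD1 i C; rewrite (cardsD1 i0 C) iC i0C => /addnI->.
  (* The two monomials differ by exchanging [i] and [i0]; cancelling the rest compares two
     variables. *)
  have -> : C :\ i0 = i |: (C :\ i0 :\ i) by rewrite setD1K // in_setD1 ii0.
  have -> : C :\ i = i0 |: (C :\ i0 :\ i).
    by rewrite setDDl (setUC [set i0] [set i]) -setDDl setD1K // in_setD1 eq_sym ii0.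
  rewrite !mnm_set_setU1 ?inE ?eqxx ?andbF // ![(U_(_) + _)%MM]addmC gp_add //.
  by apply: contra ii0 => ii0; apply/eqP/var_order_anti; rewrite imin // andbT.
have [i0 +] : exists2 i, i \in C :\: I & forall j, j \in C :\: I -> var_order j i.
  by apply: (exists_last var_order_total var_order_trans); rewrite setD_eq0.
rewrite inE => /andP[i0I i0C] imax; exists i0.
have i0CI : i0 \notin C :&: I by rewrite inE (negbTE i0I) andbF.
have i0E : circuit_mnm I C i0 = (U_(i0) + mnm_set (C :&: I))%MM.
  by rewrite /circuit_mnm (negbTE i0I) mnm_set_setU1.
split=> // [|i iC ii0].
  rewrite /circuit_mnm (negbTE i0I); congr mnm_set.
  apply/setP => j; rewrite in_broken_nsub // in_setU1 inE.
  have [->|ji0] /= := eqVneq j i0.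
    by rewrite i0C (negbTE i0I); apply/esym/forall_inP.
  have [jC|//] := boolP (j \in C); have [//|jI] := boolP (j \in I).
  apply/esym/negbTE; apply: contra ji0 => /forall_inP jmax; apply/eqP/var_order_anti.
  by rewrite imax ?jmax // inE ?i0I ?jI.
have [iI|iI] := boolP (i \in I); last first.
  have -> : circuit_mnm I C i = (U_(i) + mnm_set (C :&: I))%MM.
    by rewrite /circuit_mnm (negbTE iI) mnm_set_setU1 // inE (negbTE iI) andbF.
  rewrite i0E !mdegD !mdeg1 ![(U_(_) + _)%MM]addmC gp_add //; split=> //.
  apply: contra ii0 => ii0; apply/eqP/var_order_anti; rewrite imax //.
  by rewrite inE iI.
have iE : circuit_mnm I C i = mnm_set (C :&: I :\ i) by rewrite /circuit_mnm iI.
have CIE : mnm_set (C :&: I) = (U_(i) + mnm_set (C :&: I :\ i))%MM.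
  by rewrite -mnm_set_setU1 ?inE ?eqxx // setD1K // inE iC.
rewrite i0E iE CIE; split; last by rewrite !mdegD !mdeg1 addnA leq_addl.
(* Cancelling the common factor would put [U_(i0) + U_(i)] below the trivial monomial. *)
rewrite -[X in le _ X]addm0 addmA addmC gp_add //.
by apply/negP => /(gp_pos leP)/eqP; rewrite mnmD_eq0 mnm1_eq0.
Qed.

End MonomialPreorders.

(** * Initial ideals *)

Section Ideals.
Variables (K : numFieldType) (n : nat).
Implicit Types (G H : set {mpoly K[n]}) (p q : {mpoly K[n]}).

Lemma ideal_generated_mem G p : G p -> ideal_generated G p.
Proof.
move=> Gp; exists [:: (1, p)]; split; last by rewrite big_seq1 mul1r.
by move=> q; rewrite inE => /eqP ->.
Qed.

Lemma ideal_generated0 G : ideal_generated G 0.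
Proof. by exists [::]; split; rewrite ?big_nil. Qed.

Lemma ideal_generatedD G p q :
  ideal_generated G p -> ideal_generated G q -> ideal_generated G (p + q).
Proof.
move=> [s [sG ->]] [t [tG ->]]; exists (s ++ t); split; last by rewrite big_cat.
by move=> u; rewrite mem_cat => /orP[/sG|/tG].
Qed.

Lemma ideal_generatedM G p q : ideal_generated G q -> ideal_generated G (p * q).
Proof.
move=> [s [sG ->]]; exists [seq (p * u.1, u.2) | u <- s]; split.
  by move=> u /mapP[v vs ->]; exact: sG v vs.
by rewrite big_map mulr_sumr; apply: eq_bigr => u _; rewrite mulrA.
Qed.

Lemma ideal_generatedZ G c q : ideal_generated G q -> ideal_generated G (c *: q).
Proof. by rewrite -mul_mpolyC; exact: ideal_generatedM. Qed.

Lemma ideal_generated_sub G H :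
  (G `<=` ideal_generated H -> ideal_generated G `<=` ideal_generated H)%classic.
Proof.
move=> GH p [s [sG ->]]; rewrite big_seq.
apply: (big_ind (fun p => ideal_generated H p)).
- exact: ideal_generated0.
- exact: ideal_generatedD.
- by move=> u /sG/GH; exact: ideal_generatedM.
Qed.

Lemma initial_form_lead (le : rel 'X_{1..n}) p m : total le ->
  m \in msupp p -> {in msupp p, forall m', m' != m -> ~~ le m m'} ->
  initial_form le p = p@_m *: 'X_[m].
Proof.
move=> le_total mp mlead; rewrite /initial_form big_mkcond /=.
rewrite (bigD1_seq m) ?msupp_uniq //= ifT; last first.
  apply/allP => m' m'p; have [->|/(mlead _ m'p)] := eqVneq m' m.
    by have := le_total m m; rewrite orbb.
  by move=> /negbTE mm'; have := le_total m' m; rewrite mm' orbF.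
rewrite big_seq_cond big1 ?addr0 // => m' /andP[m'p m'm]; case: allP => // /(_ m mp).
by rewrite (negbTE (mlead _ m'p m'm)).
Qed.

End Ideals.

(** * The vanishing ideal of inv_I(L) *)

Section SemiInvertedSpaces.
Variables (K : numFieldType) (n : nat) (L : {vspace 'rV[K]_n}) (I : {set 'I_n}).
Implicit Types (C S : {set 'I_n}) (a x : 'rV[K]_n) (f g : {mpoly K[n]}) (m : 'X_{1..n}).

Local Notation J := (vanishing_ideal (inv_variety I L)).

Lemma vanishing_ideal_inv f : J f <->
  (forall x, x \in L -> inv_domain I x -> f.@[inv_coords I x 0] = 0).
Proof.
split=> [Jf x xL xI|fL x]; last by apply=> _ [y [yL yI] <-]; exact: fL.
by apply: Jf => p; apply; exists x.
Qed.

Lemma vanishing_idealD f g : J f -> J g -> J (f + g).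
Proof. by move=> Jf Jg x xV; rewrite mevalD Jf // Jg // addr0. Qed.

Lemma vanishing_idealM f g : J g -> J (f * g).
Proof. by move=> Jg x xV; rewrite mevalM Jg // mulr0. Qed.

Lemma vanishing_idealZ c f : J f -> J (c *: f).
Proof. by rewrite -mul_mpolyC; exact: vanishing_idealM. Qed.

Lemma vanishing_ideal_sum (T : eqType) (s : seq T) (P : pred T) (F : T -> {mpoly K[n]}) :
  {in s, forall i, P i -> J (F i)} -> J (\sum_(i <- s | P i) F i).
Proof.
move=> JF; rewrite big_seq_cond; apply: (big_ind (fun f => J f)).
- by move=> x _; rewrite meval0.
- exact: vanishing_idealD.
- by move=> i /andP[]; exact: JF.
Qed.

(** inv_I is an involution on its domain, so at inv_I(x) the circuit polynomial is a multiple of the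
    circuit form at [x]. *)
Lemma vanishing_ideal_circuit C a : circuit_form L C a -> J (circuit_poly I C a).
Proof.
move=> [aL aC]; apply/vanishing_ideal_inv => x xL xI.
have yI : inv_domain I (inv_coords I x) by move=> i iI; rewrite mxE iI invr_eq0 xI.
rewrite (circuit_polyE aC yI); have -> : inv_coords I (inv_coords I x) = x.
  by apply/rowP => i; rewrite !mxE; case: (i \in I); rewrite ?invrK.
by rewrite aL // mulr0.
Qed.

Lemma twist_meval f N x : inv_domain I x -> {in msupp f, forall m j, (m j <= N j)%N} ->
  (twist N (fun m => f@_m) I setT (msupp f)).@[x 0] =
    \prod_(j in I) x 0 j ^+ N j * f.@[inv_coords I x 0].
Proof.
move=> xI fN; rewrite (mevalE _ f) mulr_sumr /twist raddf_sum /=; apply: eq_big_seq => m mf.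
rewrite mevalZ [RHS]mulrCA; congr (_ * _); rewrite rmorph_prod big_mkcond /=.
rewrite [X in _ = X * _]big_mkcond -big_split /=; apply: eq_bigr => j _.
rewrite in_setT rmorphXn /= mevalXU mxE /twist_exp; case: ifP => jI; last by rewrite mul1r.
by rewrite exprVn -[in RHS](subnK (fN m mf j)) exprD mulfK // expf_neq0 // xI.
Qed.

Section Order.
Variable r : rel 'I_n.
Hypotheses (r_total : total r) (r_anti : antisymmetric r) (r_trans : transitive r).

Definition broken_complex : set {set 'I_n} :=
  [set S : {set 'I_n} | forall C, circuit L C -> ~~ (broken r I C \subset S)]%classic.

(** For nonzero [f] the twist is nonzero somewhere on [L], and by irreducibility even at a point of
    the domain of inv_I. There it is a multiple of the value of [f] at inv_I(x), which is zero. *)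
Lemma standard_vanishing_eq0 f : J f ->
  {in msupp f, forall m, broken_complex (mnm_supp m)} -> f = 0.
Proof.
move=> Jf fstd; apply/eqP/negPn/negP => f0.
have s0 : msupp f != [::] by rewrite msupp_eq0.
pose N j := (\max_(m <- msupp f) m j)%N.
have fN : {in msupp f, forall m j, (m j <= N j)%N}.
  by move=> m mf j; rewrite /N; exact: (leq_bigmax_seq (F := fun m => m j)).
have fnbc : {in msupp f, forall m, f@_m != 0 /\ nbc r L I setT (mnm_supp m)}.
  move=> m mf; split; first by rewrite -mcoeff_msupp.
  by apply: nbc_circuit => //; exact: fstd.
(* The mere presence of a standard monomial rules out loops in [I], so the domain of inv_I meets
   [L]. *)
have loopless i : i \in I -> exists2 x, x \in L & x 0 i != 0.
  move=> iI; case E : (msupp f) s0 => [//|m s] _.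
  have [|_ mnbc] := fnbc m; first by rewrite E mem_head.
  by apply: (nbc_nonloop r_total mnbc); rewrite ?iI ?in_setT.
have twist0 : exists2 x, x \in L & (twist N (fun m => f@_m) I setT (msupp f)).@[x 0] != 0.
  apply: (nbc_twist_neq0 r_total r_anti r_trans) => //.
  by move=> m m' _ _ j; rewrite in_setT.
have [x xL] := meval_mul_neq0 (meval_prod_neq0 loopless) twist0.
rewrite mevalM mulf_eq0 negb_or => /andP[xI].
have {}xI : inv_domain I x.
  move=> i iI; apply: contraNneq xI => xi0; rewrite rmorph_prod (bigD1 i) //=.
  by rewrite mevalXU xi0 mul0r.
by rewrite twist_meval // (vanishing_ideal_inv f).1 // mulr0 eqxx.
Qed.

End Order.

(** * Reduction to standard monomials and computation of the initial ideal *)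

Section Preorder.
Variable le : rel 'X_{1..n}.
Hypothesis leP : generic_preorder le.

Local Notation r := (var_order le).
Local Notation std m := (broken_complex r (mnm_supp m)).

(** Division by the circuit polynomials. Well-foundedness of [le] is not assumed: the measure counts
    the monomials of degree below a fixed [D] that are strictly smaller than [m], and division never
    raises the degree. *)
Lemma normal_form m : exists t, [/\ J ('X_[m] - t),
  {in msupp t, forall m', std m' /\ (m' = m \/ ~~ le m m')} & std m -> t = 'X_[m]].
Proof.
pose D := (mdeg m).+1; have : (mdeg m < D)%N by [].
have [k] := ubnP #|[set b : 'X_{1..n < D} | ~~ le m b]|; move: D => D.
elim: k m => // k IHk m; rewrite ltnS => mk mD.
have [mstd|] := EM (std m).
  exists 'X_[m]; split=> //; first by rewrite subrr => x _; rewrite meval0.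
  by move=> m'; rewrite msuppX inE => /eqP ->; split; last left.
move=> mstd; have /existsNP[C /not_implyP[Cc /negP/negPn Cm]] := mstd.
have [[a [a0 aL aC]] _] := Cc.
have [i0 [i0C i0E i0max]] := circuit_mnm_lead leP I (circuit_neq0 Cc).
have ai0 : a 0 i0 != 0 by move: i0C; rewrite -aC inE.
pose m0 := (m - circuit_mnm I C i0)%MM.
have mE : m = (m0 + circuit_mnm I C i0)%MM by rewrite submK // i0E mnm_set_le.
pose mu i := (m0 + circuit_mnm I C i)%MM.
have mu_lt i : i \in C -> i != i0 -> ~~ le m (mu i) /\ (mdeg (mu i) <= mdeg m)%N.
  move=> iC ii0; have [lti degi] := i0max i iC ii0.
  by rewrite mE /mu gp_add // !mdegD leq_add2l.
have IHmu i : exists t, i \in C :\ i0 -> [/\ J ('X_[mu i] - t),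
    {in msupp t, forall m', std m' /\ (m' = mu i \/ ~~ le (mu i) m')}
    & std (mu i) -> t = 'X_[mu i]].
  have [|_] := boolP (i \in C :\ i0); last by exists 0.
  rewrite in_setD1 => /andP[ii0 iC]; have [lti degi] := mu_lt i iC ii0.
  have muD := leq_ltn_trans degi mD.
  have [|//|t tP] := IHk (mu i); last by exists t.
  (* The count drops because [mu i] is strictly below [m] but not below itself. *)
  apply: leq_trans mk; apply: proper_card; apply/properP; split.
    apply/fintype.subsetP => b; rewrite !inE; apply: contra => mb.
    have := gp_total leP (mu i) b; case/orP => // bmu.
    by rewrite (gp_trans leP mb bmu) in lti.
  by exists (BMultinom muD); rewrite !inE //= negbK gp_refl.
have [t tP] := choice IHmu.
exists (\sum_(i in C :\ i0) - (a 0 i / a 0 i0) *: t i); split=> //.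
(* Subtracting the normalized multiple of the circuit polynomial cancels [m] and leaves the [mu i],
   which are then replaced by their normal forms. *)
- have -> : 'X_[m] - \sum_(i in C :\ i0) - (a 0 i / a 0 i0) *: t i =
      (a 0 i0)^-1 *: ('X_[m0] * circuit_poly I C a) -
      \sum_(i in C :\ i0) (a 0 i / a 0 i0) *: ('X_[mu i] - t i).
    rewrite circuit_poly_sum mulr_sumr (big_setD1 i0 i0C) /= scalerDr.
    rewrite -scalerAr scalerA mulVf // scale1r -mpolyXD -mE -addrA; congr (_ + _).
    rewrite scaler_sumr -!sumrN -big_split /=; apply: eq_bigr => i _.
    rewrite -scalerAr scalerA -mpolyXD -/(mu i) [_^-1 * _]mulrC.
    by rewrite scaleNr opprK scalerBr opprB [RHS]addrC subrK.
  apply: vanishing_idealD.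
    by apply/vanishing_idealZ/vanishing_idealM/vanishing_ideal_circuit.
  rewrite -sumrN; apply: vanishing_ideal_sum => i _ iC; rewrite -scaleNr.
  by apply: vanishing_idealZ; have [] := tP i iC.
- move=> m'; rewrite mcoeff_msupp raddf_sum /= => m'0.
  have [i iC m'i] : exists2 i, i \in C :\ i0 & m' \in msupp (t i).
    apply/exists_inP; apply: contraNT m'0 => /exists_inPn tm'.
    rewrite big1 // => i /tm' /memN_msupp_eq0 ti; rewrite mcoeffZ.
    by rewrite ti mulr0.
  have [_ /(_ m' m'i)[m'std m'lt] _] := tP i iC; split=> //; right.
  move: iC; rewrite in_setD1 => /andP[ii0 iC]; have [lti _] := mu_lt i iC ii0.
  case: m'lt => [->//|muNle]; apply: contra lti => mm'.
  have := gp_total leP (mu i) m'; rewrite (negbTE muNle) /=; exact: (gp_trans leP).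
Qed.

(** Replacing each monomial of [f] by its normal form gives a standard element of the ideal, hence
    0. A standard [m] would keep its coefficient: it is its own normal form, and by maximality no
    other normal form contains it. *)
Lemma lead_nonstandard f m : J f -> m \in msupp f ->
  {in msupp f, forall m', le m' m} -> ~ std m.
Proof.
move=> Jf mf mmax mstd; have [t tP] := choice normal_form.
pose g := \sum_(m' <- msupp f) f@_m' *: t m'.
have Jg : J g.
  have -> : g = f + -1 *: (\sum_(m' <- msupp f) f@_m' *: ('X_[m'] - t m')).
    rewrite [X in X + _]mpolyE scaleN1r -sumrN -big_split /=; apply: eq_bigr => m' _.
    by rewrite scalerBr opprB [RHS]addrC subrK.
  apply: vanishing_idealD => //; apply/vanishing_idealZ/vanishing_ideal_sum => m' _ _.
  by apply: vanishing_idealZ; have [] := tP m'.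
have g0 : g = 0.
  apply: (standard_vanishing_eq0 (var_order_total leP) (var_order_anti leP)
    (@var_order_trans _ _ leP)) => // m'.
  rewrite mcoeff_msupp raddf_sum /= => m'0.
  have /hasP[m1 m1f] : has (fun m1 => m' \in msupp (t m1)) (msupp f).
    apply: contraNT m'0 => /hasPn tm'; rewrite big_seq big1 // => m1 /tm'.
    by move/memN_msupp_eq0 => tm1; rewrite mcoeffZ tm1 mulr0.
  by have [_ tm1 _] := tP m1 => /tm1[].
have : f@_m = 0.
  have := congr1 (mcoeff m) g0.
  rewrite mcoeff0 raddf_sum /= (bigD1_seq m) ?msupp_uniq //= mcoeffZ.
  have [_ _ ->//] := tP m; rewrite mcoeffX eqxx mulr1.
  rewrite big_seq_cond big1 ?addr0 // => m' /andP[m'f m'm]; rewrite mcoeffZ.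
  rewrite (@memN_msupp_eq0 _ _ (t m')) ?mulr0 //; have [_ tm' _] := tP m'.
  apply/negP => /tm'[_ [mm'|]]; first by rewrite mm' eqxx in m'm.
  by rewrite mmax.
by apply/eqP; rewrite -mcoeff_msupp.
Qed.

Local Notation SR := (@stanley_reisner_ideal K n (broken_complex r)).

(** Every maximal term of [f] is nonstandard, tied ones included, and so is a multiple of the
    squarefree monomial of its support, a nonface. *)
Lemma initial_ideal_sub_stanley_reisner : (initial_ideal le J `<=` SR)%classic.
Proof.
apply: ideal_generated_sub => _ [f Jf <-]; rewrite /initial_form big_seq_cond.
apply: (big_ind (fun p => SR p)).
- exact: ideal_generated0.
- exact: ideal_generatedD.
move=> m /andP[mf /allP mmax]; apply: ideal_generatedZ.
have mstd := lead_nonstandard Jf mf mmax.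
rewrite -(submK (mnm_set_supp m)) mpolyXD; apply/ideal_generatedM/ideal_generated_mem.
by exists (mnm_supp m) => //; exact: sqfree_monomialE.
Qed.

Lemma initial_form_circuit_poly C a : circuit L C -> circuit_form L C a ->
  exists2 c, c != 0 &
    initial_form le (circuit_poly I C a) = c *: 'X_[mnm_set (broken r I C)].
Proof.
move=> Cc [aL aC]; have [i0 [i0C <- i0max]] := circuit_mnm_lead leP I (circuit_neq0 Cc).
have ai0 : a 0 i0 != 0 by move: i0C; rewrite -aC inE.
have coef : (circuit_poly I C a)@_(circuit_mnm I C i0) = a 0 i0.
  rewrite circuit_poly_sum raddf_sum (bigD1 i0) //= mcoeffZ mcoeffX eqxx mulr1.
  rewrite big1 ?addr0 // => i /andP[iC ii0]; rewrite mcoeffZ mcoeffX.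
  case: eqP => [ei|_]; last by rewrite mulr0.
  by have [] := i0max i iC ii0; rewrite ei gp_refl.
exists (a 0 i0) => //; rewrite -coef; apply: initial_form_lead; first exact: gp_total.
  by rewrite mcoeff_msupp coef.
move=> m; rewrite mcoeff_msupp circuit_poly_sum raddf_sum /= => m0 mi0.
have [i iC mi] : exists2 i, i \in C & m == circuit_mnm I C i.
  apply/exists_inP; apply: contraNT m0 => /exists_inPn Cm.
  rewrite big1 // => i /Cm mi; rewrite mcoeffZ mcoeffX eq_sym (negbTE mi).
  by rewrite mulr0.
have [ii0|ii0] := eqVneq i i0; first by rewrite (eqP mi) ii0 eqxx in mi0.
by rewrite (eqP mi); have [] := i0max i iC ii0.
Qed.

(** A nonface contains a broken circuit, so its monomial is a multiple of the initial form of that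
    circuit's polynomial. *)
Lemma stanley_reisner_sub_initial_circuits (ell : {set 'I_n} -> 'rV[K]_n) :
  (forall C, circuit L C -> circuit_form L C (ell C)) ->
  (SR `<=` ideal_generated
     [set initial_form le f | f in [set circuit_poly I C (ell C) | C in circuit L]])%classic.
Proof.
move=> ellP; apply: ideal_generated_sub => _ [S SN <-].
have /existsNP[C /not_implyP[Cc /negP/negPn CS]] := SN.
have [c c0 cE] := initial_form_circuit_poly Cc (ellP C Cc).
rewrite sqfree_monomialE -(@submK _ (mnm_set (broken r I C)) (mnm_set S)); last first.
  by apply: mnm_set_le; rewrite mnm_supp_set.
rewrite mpolyXD; apply: ideal_generatedM.
rewrite -[X in ideal_generated _ X]scale1r -(mulVf c0) -scalerA -cE.
apply/ideal_generatedZ/ideal_generated_mem.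
by exists (circuit_poly I C (ell C)) => //; exists C.
Qed.

Lemma initial_circuits_sub_initial_ideal (ell : {set 'I_n} -> 'rV[K]_n) :
  (forall C, circuit L C -> circuit_form L C (ell C)) ->
  (ideal_generated
     [set initial_form le f | f in [set circuit_poly I C (ell C) | C in circuit L]]
   `<=` initial_ideal le J)%classic.
Proof.
move=> ellP; apply: ideal_generated_sub => _ [_ [C Cc <-] <-].
apply: ideal_generated_mem; exists (circuit_poly I C (ell C)) => //.
exact/vanishing_ideal_circuit/ellP.
Qed.

(** The inclusions close a cycle through the ideal of the initial forms of the circuit polynomials,
    for any choice of circuit forms. *)
Lemma initial_ideal_stanley_reisner : initial_ideal le J = SR.
Proof.
have /choice[ell ellP] : forall C, exists a, circuit L C -> circuit_form L C a.
  move=> C; have [[[a [_ aL aC]] _]|] := EM (circuit L C); first by exists a.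
  by exists 0.
apply/seteqP; split; first exact: initial_ideal_sub_stanley_reisner.
by move=> f /(stanley_reisner_sub_initial_circuits ellP)
  /(initial_circuits_sub_initial_ideal ellP).
Qed.

Lemma groebner_basis_circuits (ell : {set 'I_n} -> 'rV[K]_n) :
  (forall C, circuit L C -> circuit_form L C (ell C)) ->
  groebner_basis le [set circuit_poly I C (ell C) | C in circuit L]%classic J.
Proof.
move=> ellP; split.
- exact/finite_image/finite_finset.
- by move=> _ [C /ellP/vanishing_ideal_circuit CJ <-].
apply/seteqP; split; first exact: initial_circuits_sub_initial_ideal.
by rewrite initial_ideal_stanley_reisner; exact: stanley_reisner_sub_initial_circuits.
Qed.

End Preorder.

End SemiInvertedSpaces.

(** Totality and antisymmetry upgrade compatibility with multiplication to cancellation. *)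
Lemma monomial_order_generic n (le : rel 'X_{1..n}) :
  monomial_order le -> generic_preorder le.
Proof.
move=> [le_total le_anti le_trans le0 leD].
have le_refl m : le m m by have := le_total m m; rewrite orbb.
split=> // [m m1 m2|m m0|i j ij ji].
- apply/idP/idP => [le12|]; last exact: leD.
  have [//|/leD-/(_ m) le21] := orP (le_total m1 m2).
  have /eqP : (m + m1 = m + m2)%MM by apply: le_anti; rewrite le12.
  by rewrite eqm_add2l => /eqP ->.
- by apply: le_anti; rewrite m0 le0.
have /mnmP/(_ j) : (U_(i) = U_(j) :> 'X_{1..n})%MM by apply: le_anti; rewrite ij.
by rewrite !mnm1E eqxx; case: eqP.
Qed.

Section Weights.
Variables (R : realType) (n : nat) (w : 'I_n -> R).
Hypotheses (w_gt0 : forall i, 0 < w i) (w_inj : injective w).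

Lemma weight_leU i j : weight_le w U_(i)%MM U_(j)%MM = (w i <= w j).
Proof.
have wU k : \sum_l w l * (U_(k)%MM l)%:R = w k :> R.
  rewrite (bigD1 k) //= mnm1E eqxx mulr1 big1 ?addr0 // => l lk.
  by rewrite mnm1E eq_sym (negbTE lk) mulr0.
by rewrite /weight_le !wU.
Qed.

(** Positive weights leave 1 as the only monomial of weight at most 0, and injectivity of [w]
    separates the variables. *)
Lemma weight_le_generic : generic_preorder (weight_le w).
Proof.
split=> [m m'|m m' m''|m m1 m2|m|i j].
- exact: le_total.
- exact: le_trans.
- have wD m' : \sum_i w i * ((m + m')%MM i)%:R =
      \sum_i w i * (m i)%:R + \sum_i w i * (m' i)%:R.
    by rewrite -big_split; apply: eq_bigr => i _; rewrite mnmDE natrD mulrDr.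
  by rewrite /weight_le !wD lerD2l.
- rewrite /weight_le [X in _ <= X]big1 => [m0|i _]; last by rewrite mnm0E mulr0.
  have wm_ge0 i : true -> 0 <= w i * (m i)%:R by rewrite mulr_ge0 // ltW.
  have /eqP : \sum_i w i * (m i)%:R = 0 by apply/le_anti; rewrite m0 sumr_ge0.
  rewrite psumr_eq0 // => /allP wm; apply/mnmP => i; rewrite mnm0E.
  have := wm i (mem_index_enum i); rewrite mulf_eq0 gt_eqF //=.
  by rewrite pnatr_eq0 => /eqP.
- by rewrite !weight_leU => ij ji; apply/w_inj/le_anti; rewrite ij.
Qed.

(** The variable [x_i] has weight [w i], so both orders of [n] coincide and the two complexes become
    convertible. *)
Lemma broken_circuit_complex_weight (K : numFieldType) (L : {vspace 'rV[K]_n}) I :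
  broken_circuit_complex w (circuit L) I = broken_complex L I (var_order (weight_le w)).
Proof.
have -> : var_order (weight_le w) = (fun i j => w i <= w j).
  by apply/funext => i; apply/funext => j; exact: weight_leU.
by [].
Qed.

End Weights.

Theorem theorem1p1 (R : realType) (n d : nat) (L : {vspace 'rV[R[i]]_n})
    (I : {set 'I_n}) (dimL : \dim L = d) :
  (forall ell : {set 'I_n} -> 'rV[R[i]]_n,
     (forall C : {set 'I_n}, circuit L C -> circuit_form L C (ell C)) ->
     universal_groebner_basis
       [set circuit_poly I C (ell C) | C in circuit L]%classic
       (vanishing_ideal (inv_variety I L)))
  /\
  (forall w : 'I_n -> R,
     (forall i : 'I_n, 0 < w i) -> injective w ->
     initial_ideal (weight_le w) (vanishing_ideal (inv_variety I L)) =
     stanley_reisner_ideal (broken_circuit_complex w (circuit L) I)).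
Proof.
split=> [ell ellP|w w_gt0 w_inj].
  split=> [||le le_mon].
  - exact/finite_image/finite_finset.
  - by move=> _ [C /ellP/vanishing_ideal_circuit CJ <-].
  - exact: (@groebner_basis_circuits _ n L I le (monomial_order_generic le_mon) ell ellP).
rewrite broken_circuit_complex_weight.
exact/initial_ideal_stanley_reisner/weight_le_generic.
Qed.
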